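(* Let $a>1$ and consider the system of difference equations $$x_{n+1}=\frac{x_n}{a+y_n},\qquad y_{n+1}=\frac{y_n}{1+x_n},\qquad n=0,1,2,\ldots,\quad x_0,y_0\ge 0.$$ Then: (i) Every solution converges to an equilibrium $(0,\overline{y})$ for some $\overline{y}\ge 0$. (ii) At each equilibrium $(0,\overline{y})$ with $\overline{y}>0$, the stable set $\mathcal{W}^s((0,\overline{y}))$ is an unbounded increasing curve $\mathcal{C}$ that starts at $(0,\overline{y})$. (iii) The limiting equilibrium varies continuously with the initial condition.
   Context: Let $T(x,y)=\left(\frac{x}{a+y},\frac{y}{1+x}\right)$ on $[0,\infty)^2$. The stable set of a fixed point $\overline{\mathrm{x}}$ is $\mathcal{W}^s(\overline{\mathrm{x}})=\{\mathrm{x}\in[0,\infty)^2:T^n(\mathrm{x})\to\overline{\mathrm{x}}\}$. An increasing curve is the graph of a strictly increasing continuous function of the first coordinate on an interval. Statement (iii) means that the function $T^*(x,y):=\lim_{n\to\infty}T^n(x,y)$ is continuous on $[0,\infty)^2$. *)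

(* Defs.v *)
From HB Require Import structures.
From mathcomp Require Import all_boot all_order all_algebra.
From mathcomp Require Import all_classical all_reals all_analysis.
Set Implicit Arguments.
Unset Strict Implicit.
Unset Printing Implicit Defensive.
Import Order.TTheory GRing.Theory Num.Theory.
Import numFieldNormedType.Exports.
Local Open Scope classical_set_scope.
Local Open Scope ring_scope.

(* The library only makes products of pointed topological spaces pointed and
   topological separately; the joint structure is needed for [lim] on [R * R]. *)
HB.instance Definition _ (T T' : ptopologicalType) :=
  Pointed.on (T * T')%type.

Section PlanarMap.
Context {R : realType}.
Implicit Types (a : R) (p q : R * R) (C : set (R * R)).

Definition quadrant : set (R * R) := [set p | 0 <= p.1 /\ 0 <= p.2].

Definition T a p : R * R := (p.1 / (a + p.2), p.2 / (1 + p.1)).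

Definition solution a (x y : nat -> R) : Prop :=
  [/\ 0 <= x 0%N, 0 <= y 0%N,
      forall n, x n.+1 = x n / (a + y n)
    & forall n, y n.+1 = y n / (1 + x n)].

Definition equilibrium a p : Prop := quadrant p /\ T a p = p.

Definition stable_set a q : set (R * R) :=
  [set p | quadrant p /\ iter n (T a) p @[n --> \oo] --> q].

(* [lim] takes an unspecified value when the orbit of [p] does not converge. *)
Definition Tstar a p : R * R := lim (iter n (T a) p @[n --> \oo]).

(* Only the restriction of [f] to [I] matters. *)
Definition increasing_curve C : Prop :=
  exists (I : interval R) (f : R -> R),
    [/\ {in I &, {homo f : s t / s < t}},
        {within [set` I], continuous f}
      & C = [set p | p.1 \in I /\ p.2 = f p.1]].

(* For an increasing curve this says that [p] is its left endpoint. *)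
Definition starts_at C p : Prop := C p /\ forall q, C q -> p.1 <= q.1.

End PlanarMap.

(* Main.v *)
(** Along an orbit [x_n] decays geometrically and [y_n] decreases, while
    [y_n * exp (- K x_n)] increases for [K = a / (a - 1)]; the last two
    sequences have the same limit, written [ylim]. Being squeezed between two monotone sequences
    of continuous functions, [ylim] is continuous. The map is competitive, so
    [ylim (x, y)] is strictly increasing in [y] and, for [y > 0], strictly
    decreasing in [x]; the level set [ylim = ybar] is then the graph of an
    increasing function, total by the intermediate value theorem and continuous
    because [ylim] is. *)

Require Import Defs.
From mathcomp Require Import all_boot all_order all_algebra.
From mathcomp Require Import all_classical all_reals all_analysis.
From mathcomp Require Import ring lra.
Set Implicit Arguments.
Unset Strict Implicit.
Unset Printing Implicit Defensive.
Import Order.TTheory GRing.Theory Num.Theory.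
Import numFieldNormedType.Exports.
Local Open Scope classical_set_scope.
Local Open Scope ring_scope.

(** Serves to restrict continuity relative to [quadrant] to horizontal and vertical lines. *)
Lemma within_cvg_within (S U : topologicalType) (A : set S) (B : set U)
    (f : S -> U) (s : S) :
  {for s, continuous f} -> (forall t, A t -> B (f t)) ->
  f t @[t --> within A (nbhs s)] --> within B (nbhs (f s)).
Proof.
move=> fs AB D BD; change (nbhs s (fun t => A t -> D (f t))).
have fBD : nbhs s (fun t => B (f t) -> D (f t)) := fs _ BD.
by apply: filterS fBD => t DBt At; exact: DBt (AB _ At).
Qed.

Section Orbits.
Context {R : realType}.
Implicit Types (a : R) (p q : R * R).

(** * One-step estimates on the quadrant *)

Lemma T_quadrant a p : 1 < a -> quadrant p -> quadrant (T a p).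
Proof.
case: p => x y a1 [/= x0 y0]; split => /=; apply: divr_ge0 => //; lra.
Qed.

Lemma iter_T_quadrant a p n :
  1 < a -> quadrant p -> quadrant (iter n (T a) p).
Proof. by move=> a1 p0; elim: n => //= n; exact: T_quadrant. Qed.

Lemma quadrant_denom a p : 1 < a -> quadrant p -> 0 < a + p.2 /\ 0 < 1 + p.1.
Proof. by move=> a1 [x0 y0]; split; lra. Qed.

Lemma fst_T_le a p : 1 < a -> quadrant p -> (T a p).1 <= p.1 / a.
Proof.
case: p => x y a1 [/= x0 y0]; apply: ler_wpM2l => //.
by rewrite lef_pV2 ?posrE; lra.
Qed.

Lemma snd_T_le a p : quadrant p -> (T a p).2 <= p.2.
Proof. by case: p => x y [/= x0 y0]; rewrite ler_pdivrMr; nra. Qed.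

(** A lower bound for the limit of [y_n]: each step divides [y_n] by [1 + x_n <= expR x_n], and
    [x_n <= x / a ^ n] sums to at most [a / (a - 1) * x]. *)
Definition lyapunov a p : R := p.2 * expR (- (a / (a - 1) * p.1)).

(* With K = a / (a - 1) one has 1 + K / a = K, and 1 + x <= exp x. *)
Lemma lyapunov_T a p : 1 < a -> quadrant p -> lyapunov a p <= lyapunov a (T a p).
Proof.
move=> a1 p0; have := fst_T_le a1 p0; have [_ d0] := quadrant_denom a1 p0.
case: p p0 d0 => x y [/= x0 y0] d0; rewrite /lyapunov /=.
set x' := x / (a + y) => x'_le; rewrite -[leRHS]mulrA; apply: (ler_wpM2l y0).
have K0 : 0 <= a / (a - 1) by apply: divr_ge0; lra.
apply: (@le_trans _ _ (expR (- x) * expR (- (a / (a - 1) * x')))).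
  rewrite -expRD ler_expR -opprD lerN2.
  have -> : a / (a - 1) * x = x + a / (a - 1) * (x / a) by field; apply/andP; lra.
  by rewrite lerD2l ler_wpM2l.
rewrite ler_wpM2r ?expR_ge0 // expRN lef_pV2 ?posrE ?expR_gt0 //.
exact: expR_ge1Dx.
Qed.

(** * Convergence of orbits and bounds on the limit *)

Definition ylim a p : R := lim ((iter n (T a) p).2 @[n --> \oo]).

Lemma iter_T_fst_cvg a p : 1 < a -> quadrant p ->
  (iter n (T a) p).1 @[n --> \oo] --> 0.
Proof.
move=> a1 p0; have a0 : 0 < a by lra.
apply: (@squeeze_cvgr _ _ _ _ (fun=> 0) (geometric p.1 a^-1)).
- near=> n; apply/andP; split; first by case: (iter_T_quadrant n a1 p0).
  rewrite /geometric /=; elim: (n) => [|k ih]; first by rewrite expr0 mulr1.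
  apply: (le_trans (fst_T_le a1 (iter_T_quadrant k a1 p0))).
  by rewrite exprSr mulrA ler_wpM2r // invr_ge0 ltW.
- exact: cvg_cst.
- apply: cvg_geometric; rewrite ger0_norm ?invr_ge0 ?ltW //.
  by rewrite invf_lt1.
Unshelve. all: by end_near. Qed.

Lemma iter_T_snd_nonincreasing a p : 1 < a -> quadrant p ->
  {homo (fun n => (iter n (T a) p).2) : n m / (n <= m)%N >-> m <= n}.
Proof.
move=> a1 p0; apply/nonincreasing_seqP => n.
exact: snd_T_le (iter_T_quadrant n a1 p0).
Qed.

Lemma iter_T_snd_is_cvg a p : 1 < a -> quadrant p ->
  cvgn (fun n => (iter n (T a) p).2).
Proof.
move=> a1 p0; apply: nonincreasing_is_cvgn; first exact: iter_T_snd_nonincreasing.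
by exists 0 => _ [n _ <-]; case: (iter_T_quadrant n a1 p0).
Qed.

Lemma ylim_le a p n : 1 < a -> quadrant p -> ylim a p <= (iter n (T a) p).2.
Proof.
move=> a1 p0; apply: (nonincreasing_cvgn_ge (iter_T_snd_nonincreasing a1 p0)).
exact: iter_T_snd_is_cvg.
Qed.

Lemma iter_T_cvg a p : 1 < a -> quadrant p ->
  iter n (T a) p @[n --> \oo] --> (0, ylim a p).
Proof.
move=> a1 p0.
rewrite [X in X n @[n --> _]](_ : _ =
  fun n => ((iter n (T a) p).1, (iter n (T a) p).2)); last first.
  by apply/funext => n; case: (iter _ _ _).
exact: cvg_pair (iter_T_fst_cvg a1 p0) (iter_T_snd_is_cvg a1 p0).
Qed.

Lemma lyapunov_continuous a : continuous (lyapunov a).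
Proof.
move=> p; apply: cvgM; first exact: cvg_snd.
apply: continuous_cvg; first exact: continuous_expR.
by apply: cvgN; apply: cvgM; [exact: cvg_cst|exact: cvg_fst].
Qed.

Lemma lyapunov_fst0 a (y : R) : lyapunov a (0, y) = y.
Proof. by rewrite /lyapunov /= mulr0 oppr0 expR0 mulr1. Qed.

(** Orbits tend to the vertical axis, where [lyapunov] is just the second coordinate. *)
Lemma lyapunov_cvg a p : 1 < a -> quadrant p ->
  lyapunov a (iter n (T a) p) @[n --> \oo] --> ylim a p.
Proof.
move=> a1 p0; rewrite -[ylim a p](lyapunov_fst0 a).
apply: continuous_cvg; first exact: lyapunov_continuous.
exact: iter_T_cvg.
Qed.

Lemma lyapunov_le_ylim a p n : 1 < a -> quadrant p ->
  lyapunov a (iter n (T a) p) <= ylim a p.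
Proof.
move=> a1 p0; have := @nondecreasing_cvgn_le _ (fun n => lyapunov a (iter n (T a) p)).
rewrite (cvg_lim _ (lyapunov_cvg a1 p0)) //; apply.
  apply/nondecreasing_seqP => k.
  exact: lyapunov_T (iter_T_quadrant k a1 p0).
exact: lyapunov_cvg.
Qed.

Lemma ylim_ge0 a p : 1 < a -> quadrant p -> 0 <= ylim a p.
Proof.
move=> a1 p0; apply: le_trans (lyapunov_le_ylim 0 a1 p0).
by case: p0 => _ y0; apply: mulr_ge0 => //; exact: expR_ge0.
Qed.

Lemma TstarE a p : 1 < a -> quadrant p -> Tstar a p = (0, ylim a p).
Proof.
move=> a1 p0; apply: cvg_lim; last exact: iter_T_cvg.
exact: norm_hausdorff.
Qed.

Lemma ylim_T a p : 1 < a -> quadrant p -> ylim a (T a p) = ylim a p.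
Proof.
move=> a1 p0; apply: cvg_lim => //.
rewrite (_ : (fun n => (iter n (T a) (T a p)).2) =
  [sequence (iter n.+1 (T a) p).2]_n); last first.
  by apply/funext => n; rewrite /= -iterSr.
by rewrite (cvg_shiftS (fun n => (iter n (T a) p).2)); exact: iter_T_snd_is_cvg.
Qed.

(** * Continuity of the limit *)

Lemma T_continuous a p : 1 < a -> quadrant p -> {for p, continuous (T a)}.
Proof.
move=> a1 p0; have [d1 d2] := quadrant_denom a1 p0.
have c1 : q.1 / (a + q.2) @[q --> p] --> p.1 / (a + p.2).
  apply: cvgM; first exact: cvg_fst.
  apply: cvgV; first by rewrite gt_eqF.
  by apply: cvgD; [exact: cvg_cst|exact: cvg_snd].
have c2 : q.2 / (1 + q.1) @[q --> p] --> p.2 / (1 + p.1).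
  apply: cvgM; first exact: cvg_snd.
  apply: cvgV; first by rewrite gt_eqF.
  by apply: cvgD; [exact: cvg_cst|exact: cvg_fst].
exact: cvg_pair c1 c2.
Qed.

Lemma iter_T_continuous a p n : 1 < a -> quadrant p ->
  {for p, continuous (iter n (T a))}.
Proof.
move=> a1 p0; elim: n => [|n ih]; first exact: cvg_id.
apply: continuous_comp => //.
exact: T_continuous (iter_T_quadrant n a1 p0).
Qed.

(* The orbit values of [lyapunov] and of [snd] bracket [ylim], so that it is
   both lower and upper semicontinuous. *)
Lemma ylim_continuous a p : 1 < a -> quadrant p ->
  ylim a q @[q --> within quadrant (nbhs p)] --> ylim a p.
Proof.
move=> a1 p0; apply/cvgrPdist_lt => e e0.
have [n yn] : exists n, (iter n (T a) p).2 < ylim a p + e.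
  have /cvgr_lt : (iter n (T a) p).2 @[n --> \oo] --> ylim a p.
    exact: iter_T_snd_is_cvg.
  move=> /(_ (ylim a p + e)); rewrite ltrDl => /(_ e0) /filter_ex [n].
  by exists n.
have [m vm] : exists m, ylim a p - e < lyapunov a (iter m (T a) p).
  have /cvgr_gt := lyapunov_cvg a1 p0.
  by move=> /(_ (ylim a p - e)); rewrite gtrBl => /(_ e0) /filter_ex [m]; exists m.
have yn_near : \forall q \near p, (iter n (T a) q).2 < ylim a p + e.
  have /cvgr_lt : (iter n (T a) q).2 @[q --> p] --> (iter n (T a) p).2.
    by apply: cvg_comp; [exact: iter_T_continuous|exact: cvg_snd].
  exact.
have vm_near : \forall q \near p, ylim a p - e < lyapunov a (iter m (T a) q).
  have /cvgr_gt : lyapunov a (iter m (T a) q) @[q --> p]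
      --> lyapunov a (iter m (T a) p).
    apply: continuous_comp; first exact: iter_T_continuous.
    exact: lyapunov_continuous.
  exact.
rewrite near_withinE; near=> q => q0.
have := ylim_le n a1 q0; have := lyapunov_le_ylim m a1 q0.
have : (iter n (T a) q).2 < ylim a p + e by near: q.
have : ylim a p - e < lyapunov a (iter m (T a) q) by near: q.
by move=> *; rewrite ltr_distlC; apply/andP; split; lra.
Unshelve. all: by end_near. Qed.

(** * Competitive order and strict monotonicity of the limit *)

Lemma T_mono a p q : 1 < a -> quadrant p -> quadrant q ->
  q.1 <= p.1 -> p.2 <= q.2 -> (T a q).1 <= (T a p).1 /\ (T a p).2 <= (T a q).2.
Proof.
move=> a1 p0 q0; have [] := quadrant_denom a1 p0; have [] := quadrant_denom a1 q0.
case: p p0 q0 => x y; case: q => x' y' [/= x0 y0] [/= x'0 y'0] *.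
by split; apply: ler_pM; rewrite ?invr_ge0 ?lef_pV2 ?posrE; lra.
Qed.

Lemma iter_T_mono a p q n : 1 < a -> quadrant p -> quadrant q ->
  q.1 <= p.1 -> p.2 <= q.2 ->
  (iter n (T a) q).1 <= (iter n (T a) p).1 /\
  (iter n (T a) p).2 <= (iter n (T a) q).2.
Proof.
move=> a1 p0 q0 le1 le2; elim: n => //= n [ih1 ih2].
by apply: T_mono => //; exact: iter_T_quadrant.
Qed.

(* The ratio of the second coordinates of two ordered orbits is monotone in n;
   cross-multiplied to allow [p.2 = 0]. *)
Lemma ylim_ratio a p q : 1 < a -> quadrant p -> quadrant q ->
  q.1 <= p.1 -> p.2 <= q.2 -> ylim a p * q.2 <= ylim a q * p.2.
Proof.
move=> a1 p0 q0 le1 le2.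
apply: (@ler_cvg_to _ \oo _ _ (fun n => (iter n (T a) p).2 * q.2)
  (fun n => (iter n (T a) q).2 * p.2)).
- by apply: cvgM; [exact: iter_T_snd_is_cvg|exact: cvg_cst].
- by apply: cvgM; [exact: iter_T_snd_is_cvg|exact: cvg_cst].
near=> n; elim: (n) => [|k ih] /=; first by rewrite mulrC.
(* The orbit of [q] keeps the smaller first coordinate, so its second coordinate is divided by the
   smaller number. *)
have [? _] := iter_T_mono k a1 p0 q0 le1 le2.
have pk0 := iter_T_quadrant k a1 p0; have qk0 := iter_T_quadrant k a1 q0.
have [_ ?] := quadrant_denom a1 pk0; have [_ ?] := quadrant_denom a1 qk0.
case: p0 q0 pk0 qk0 => _ ? [_ ?] [_ ?] [_ ?].
rewrite 2!(mulrAC _ _^-1); apply: ler_pM; rewrite ?mulr_ge0 ?invr_ge0 //; first by lra.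
by rewrite lef_pV2 ?posrE //; lra.
Unshelve. all: by end_near. Qed.

Lemma ylim_gt0 a p : 1 < a -> quadrant p -> 0 < p.2 -> 0 < ylim a p.
Proof.
move=> a1 p0 y0; apply: lt_le_trans (lyapunov_le_ylim 0 a1 p0).
by apply: mulr_gt0 => //; exact: expR_gt0.
Qed.

(** If [ylim a q <= ylim a p], the ratio inequality gives [ylim a q * q.2 <= ylim a q * p.2];
    cancelling [ylim a q > 0] contradicts [p.2 < q.2]. *)
Lemma ylim_lt_snd a p q : 1 < a -> quadrant p -> quadrant q ->
  q.1 <= p.1 -> p.2 < q.2 -> ylim a p < ylim a q.
Proof.
move=> a1 p0 q0 le1 lt2; have := ylim_ratio a1 p0 q0 le1 (ltW lt2).
have y0 := proj2 p0; have Lp := ylim_ge0 a1 p0; have Lq : 0 < ylim a q.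
  by apply: ylim_gt0 => //; lra.
by move=> ?; rewrite ltNge; apply/negP => ?; nra.
Qed.

(** One application of [T] leaves [ylim] unchanged and turns the strict gap in the first coordinates
    into one in the second, which reduces to [ylim_lt_snd]. *)
Lemma ylim_lt_fst a p q : 1 < a -> quadrant p -> quadrant q ->
  q.1 < p.1 -> p.2 <= q.2 -> 0 < q.2 -> ylim a p < ylim a q.
Proof.
move=> a1 p0 q0 lt1 le2 y0; rewrite -(ylim_T a1 p0) -(ylim_T a1 q0).
apply: ylim_lt_snd; [by []|exact: T_quadrant|exact: T_quadrant| |].
  by case: (T_mono a1 p0 q0 (ltW lt1) le2).
have [_ dp] := quadrant_denom a1 p0; have [_ dq] := quadrant_denom a1 q0.
apply: (@le_lt_trans _ _ (q.2 / (1 + p.1))).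
  by apply: ler_wpM2r => //; rewrite invr_ge0 ltW.
by rewrite /= ltr_pM2l // ltf_pV2 ?posrE //; lra.
Qed.

(** * Values of the limit on the axes and on vertical lines *)

Lemma ylim_eq0 a p : 1 < a -> quadrant p -> p.2 = 0 -> ylim a p = 0.
Proof.
move=> a1 p0 y0; apply/eqP; rewrite eq_le ylim_ge0 // andbT -y0.
exact: ylim_le 0%N a1 p0.
Qed.

Lemma ylim_fst0 a (y : R) : 1 < a -> 0 <= y -> ylim a (0, y) = y.
Proof.
move=> a1 y0; have p0 : quadrant ((0, y) : R * R) by [].
apply/eqP; rewrite eq_le (ylim_le 0%N a1 p0) /=.
by have := lyapunov_le_ylim 0 a1 p0; rewrite lyapunov_fst0.
Qed.

Lemma ylim_surj a (x c : R) : 1 < a -> 0 <= x -> 0 < c ->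
  exists y, 0 < y /\ ylim a (x, y) = c.
Proof.
(* [M] solves [lyapunov a (x, M) = c], so [ylim] is at least [c] at height [M], while it is 0 at
   height 0. *)
move=> a1 x0 c0; set M := c * expR (a / (a - 1) * x).
have M0 : 0 < M by apply: mulr_gt0 => //; exact: expR_gt0.
have L0 : ylim a (x, 0) = 0 by apply: ylim_eq0.
have LM : c <= ylim a (x, M).
  have := @lyapunov_le_ylim a (x, M) 0 a1 (conj x0 (ltW M0)).
  by rewrite /lyapunov /= /M expRN mulfK // gt_eqF ?expR_gt0.
have [||y] := @IVT _ (fun y => ylim a (x, y)) 0 M c (ltW M0).
- apply/subspace_continuousP => y /=; rewrite in_itv /= => /andP[y0 yM].
  apply: cvg_comp (@ylim_continuous a (x, y) a1 (conj x0 y0)).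
  apply: (@within_cvg_within _ _ _ _ (pair x)).
    exact: (cvg_pair (cvg_cst x) (@cvg_id _ (nbhs y))).
  by move=> t /=; rewrite in_itv /= => /andP[].
- by rewrite L0 ge_min ltW //= le_max LM orbT.
rewrite in_itv /= => /andP[y0 _] yc; exists y; split => //.
by rewrite lt_neqAle y0 andbT; apply/eqP => y0'; move: c0; rewrite -yc -y0' L0 ltxx.
Qed.

End Orbits.

(** * Convergence, stable curves and continuous dependence *)

Theorem theorem10 (R : realType) (a : R) (ha : 1 < a) :
  [/\ forall x y : nat -> R, solution a x y ->
        exists ybar : R, [/\ 0 <= ybar, equilibrium a (0, ybar) &
          (x n, y n) @[n --> \oo] --> ((0, ybar) : R * R)],
      forall ybar : R, 0 < ybar -> equilibrium a (0, ybar) ->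
        let C := stable_set a (0, ybar) in
        [/\ increasing_curve C, ~ bounded_set C & starts_at C (0, ybar)]
    & {within quadrant, continuous (Tstar a)}].
Proof.
have quad0 (y : R) : 0 <= y -> quadrant ((0, y) : R * R) by [].
split.
- move=> x y [x0 y0 xS yS]; have p0 : quadrant (x 0%N, y 0%N) by [].
  have xyE : (fun n => (x n, y n)) = (fun n => iter n (T a) (x 0%N, y 0%N)).
    by apply/funext; elim=> //= n <-; rewrite xS yS.
  exists (ylim a (x 0%N, y 0%N)); have L0 := ylim_ge0 ha p0; split=> //.
    by split; [exact: quad0|rewrite /T /= mul0r addr0 divr1].
  by rewrite xyE; exact: iter_T_cvg.
- move=> c c0 _ C.
  (* By uniqueness of limits, the stable set is a level set of [ylim]. *)
  have CE p : C p <-> quadrant p /\ ylim a p = c.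
    split=> -[p0 pc]; split=> //.
      have := iter_T_cvg ha p0; move/(cvg_unique (@norm_hausdorff _ _) pc).
      by case.
    by rewrite -pc; exact: iter_T_cvg.
  have [f fP] : exists f : R -> R, forall x, 0 <= x ->
      0 < f x /\ ylim a (x, f x) = c.
    have /choice[f fP] : forall x, exists y : R, 0 <= x -> 0 < y /\ ylim a (x, y) = c.
      (* The value 0 at negative [x] is arbitrary: the curve lies over [[0, +oo[]. *)
      move=> x; have [x0|_] := leP 0 x; last by exists 0.
      by have [y yP] := ylim_surj ha x0 c0; exists y.
    by exists f.
  have fq x : 0 <= x -> quadrant (x, f x).
    by move=> x0; split => //=; apply: ltW; case: (fP x x0).
  (* Strict monotonicity in [y] turns comparison with [f x] into comparison of [ylim] with [c];
     order, continuity and uniqueness for [f] are all read off from this. *)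
  have f_lt x y : 0 <= x -> 0 <= y -> (f x < y) = (c < ylim a (x, y)).
    move=> x0 y0; have [f0 fx] := fP x x0.
    have [fy|yf|<-] := ltgtP (f x) y; last by rewrite fx ltxx.
      by apply/esym; rewrite -fx; apply: ylim_lt_snd => //; exact: fq.
    apply/esym/negbTE; rewrite -leNgt -fx ltW //.
    by apply: ylim_lt_snd => //; exact: fq.
  have f_gt x y : 0 <= x -> 0 <= y -> (y < f x) = (ylim a (x, y) < c).
    move=> x0 y0; have [f0 fx] := fP x x0.
    have [yf|fy|->] := ltgtP y (f x); last by rewrite fx ltxx.
      by apply/esym; rewrite -fx; apply: ylim_lt_snd => //; exact: fq.
    apply/esym/negbTE; rewrite -leNgt -fx ltW //.
    by apply: ylim_lt_snd => //; exact: fq.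
  (* Moving right from [(s, f s)] at constant positive height brings [ylim] below [c], so the curve
     must lie higher there. *)
  have f_mono : {in `[0, +oo[ &, {homo f : s t / s < t}}.
    move=> s t; rewrite !in_itv /= !andbT => s0 t0 st.
    have [fs0 fs] := fP s s0.
    rewrite f_gt //; last exact: ltW.
    rewrite -fs.
    by apply: ylim_lt_fst => //; [split => //=; exact: ltW|exact: fq].
  have f0 : f 0 = c by have [/ltW fx <-] := fP 0 (lexx 0); rewrite ylim_fst0.
  have Cf x : 0 <= x -> C (x, f x).
    by move=> x0; apply/CE; split; [exact: fq|case: (fP x x0)].
  split.
  + exists `[0, +oo[, f; split => //.
    * apply/subspace_continuousP => x /=; rewrite in_itv /= andbT => x0.
      have [fx0 fx] := fP x x0.
      have L_cvg y : 0 <= y -> ylim a (t, y) @[t --> within [set` `[0, +oo[] (nbhs x)]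
          --> ylim a (x, y).
        move=> y0; apply: cvg_comp (@ylim_continuous _ a (x, y) ha (conj x0 y0)).
        apply: (@within_cvg_within _ _ _ _ (fun t => (t, y))).
          exact: (cvg_pair (@cvg_id _ (nbhs x)) (cvg_cst y)).
        by move=> t /=; rewrite in_itv /= andbT.
      apply/cvgrPdist_lt => e e0.
      (* capped at [f x] to keep [f x - d] nonnegative *)
      set d := Num.min e (f x); have d0 : 0 < d by rewrite lt_min e0.
      have [de df] : d <= e /\ d <= f x by rewrite /d !ge_min !lexx orbT.
      (* At heights [f x + d] and [f x - d], [ylim] lies strictly on either side of [c]; this
         persists for [t] near [x] and traps [f t] between them. *)
      have up : c < ylim a (x, f x + d) by rewrite -f_lt ?ltrDl //; lra.
      have dn : ylim a (x, f x - d) < c by rewrite -f_gt ?gtrBl //; lra.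
      have fd0 : 0 <= f x + d by lra.
      have fd1 : 0 <= f x - d by lra.
      have := cvgr_lt _ (L_cvg _ fd1) _ dn; have := cvgr_gt _ (L_cvg _ fd0) _ up.
      rewrite !near_withinE => near_up near_dn.
      near=> t => t_in.
      have t0 : 0 <= t by move: t_in; rewrite /= in_itv /= andbT.
      have : f t < f x + d by rewrite f_lt //; move: t_in; near: t; exact: near_up.
      have : f x - d < f t by rewrite f_gt //; move: t_in; near: t; exact: near_dn.
      move=> *; rewrite /from_subspace ltr_distlC; apply/andP; split; lra.
    * apply/seteqP; split=> [[x y] /CE[[/= x0 y0] xyc]|[x y] /=].
        rewrite in_itv /= x0; split => //; apply/eqP.
        by rewrite eq_le !leNgt f_lt // f_gt // xyc ltxx.
      by rewrite in_itv /= andbT => -[x0 ->]; exact: Cf.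
  (* The bound [|M| + 1] fails at the curve point of abscissa [|M| + 2], the norm on the product
     being the maximum. *)
  + move=> [M [_ /(_ (`|M| + 1))]].
    have -> : M < `|M| + 1 by have := ler_norm M; lra.
    move=> /(_ isT) /(_ _ (Cf (`|M| + 2) _)).
    have ? := normr_ge0 M; have -> : (0 <= `|M| + 2) by lra.
    move=> /(_ isT) /=; rewrite prod_normE /= ge_max => /andP[].
    by rewrite ger0_norm; lra.
  + split; first by rewrite -f0; exact: Cf.
    by move=> q /CE[[]].
- apply/subspace_continuousP => p p0; rewrite /from_subspace TstarE //.
  have FW := within_filter quadrant (nbhs_filter p).
  have L_cvg : (0 : R, ylim a q) @[q --> within quadrant (nbhs p)]
      --> ((0, ylim a p) : R * R).
    exact: cvg_pair (cvg_cst (0 : R)) (ylim_continuous ha p0).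
  (* [TstarE] identifies [Tstar] only on the quadrant, so the two functions are compared within
     it. *)
  apply: cvg_trans L_cvg; apply: near_eq_cvg; rewrite near_withinE.
  by near=> q => q0; rewrite TstarE.
Unshelve. all: by end_near. Qed.
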